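(* Let $g: R \to R'$ be a homomorphism of commutative unital rings and let $x \in R$ be such that $x$ is a non-zero-divisor in $R$ and $g(x)$ is a non-zero-divisor in $R'$. Let $\mathcal{F}_{loc}$ be the principal localization square $$\mathcal{F}_{loc}:\qquad \begin{array}{ccc} R & \to & R_x \\ {\scriptstyle g}\downarrow & & \downarrow{\scriptstyle g_x} \\ R' & \to & R'_{g(x)}. \end{array}$$ Let $P$ be one of the following two properties of modules: (b) having no $x$-torsion; (c) being finitely generated with no $x$-torsion. Assume that the functors $\mathbf{F}_{\mathcal{F}_{loc}}$ and $\mathbf{G}_{\mathcal{F}_{loc}}$ induce mutually inverse equivalences between the category $\mathcal{C}$ of $R$-modules with property $P$ and the category $\mathcal{D}$ of patching data (objects of $\mathbf{PD}(\mathcal{F}_{loc})$) with property $P$. Then the square $\mathcal{F}_{loc}$ is cartesian and surjective. (The assertion holds for each of the two choices of $P$ separately.)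
   Context: All rings are commutative and unital. $R_x = R[1/x]$ denotes localization at the powers of $x$, and $g_x: R_x \to R'_{g(x)}$ is the map induced by $g$; horizontal maps in the square are the localization maps. A module over $R$, $R_x$ or $R'$ has no $x$-torsion if multiplication by (the image of) $x$ on it is injective; finite generation is over the ring of which it is a module. Let $\mathcal{F}$ be a commutative square of rings with maps $g_1: R \to R_1$, $g_2: R \to R_2$, $h_1: R_1 \to S$, $h_2: R_2 \to S$, $h_1 g_1 = h_2 g_2$. The square is cartesian if the sequence $0 \to R \xrightarrow{\varphi} R_1 \oplus R_2 \xrightarrow{\psi} S$ is exact, where $\varphi(r) = (g_1(r), g_2(r))$ and $\psi(r_1, r_2) = h_1(r_1) - h_2(r_2)$; it is surjective if $\psi$ is surjective. The category of patching data $\mathbf{PD}(\mathcal{F})$ has as objects triples $(M_1, M_2, \zeta)$ with $M_i$ an $R_i$-module ($i=1,2$) and $\zeta: M_1 \otimes_{R_1} S \to M_2 \otimes_{R_2} S$ an isomorphism of $S$-modules; morphisms $(M_1, M_2, \zeta) \to (M_1', M_2', \zeta')$ are pairs $(f_1, f_2)$ of $R_i$-linear maps $f_i: M_i \to M_i'$ with $\zeta' \circ (f_1 \otimes 1) = (f_2 \otimes 1) \circ \zeta$. An object $(M_1, M_2, \zeta)$ has a property $P$ if both $M_1$ and $M_2$ have it. Define the functors $$\mathbf{F}_{\mathcal{F}}: R\text{-mod} \to \mathbf{PD}(\mathcal{F}),\quad M \mapsto (M \otimes_R R_1, M \otimes_R R_2, \mathrm{id}_{M \otimes_R S}),$$ $$\mathbf{G}_{\mathcal{F}}: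 \mathbf{PD}(\mathcal{F}) \to R\text{-mod},\quad (M_1, M_2, \zeta) \mapsto \{(m_1, m_2) \in M_1 \oplus M_2 : \zeta(m_1 \otimes 1) = m_2 \otimes 1\}.$$ Categories of modules or patching data with property $P$ are full subcategories. That the functors induce mutually inverse equivalences between $\mathcal{C}$ and $\mathcal{D}$ means that they restrict to functors $\mathcal{C} \to \mathcal{D}$ and $\mathcal{D} \to \mathcal{C}$ whose two composites are naturally isomorphic to the identity functors. For $\mathcal{F}_{loc}$ one takes $R_1 = R_x$, $R_2 = R'$, $S = R'_{g(x)}$. *)

(* Defs.v *)
From HB Require Import structures.
From mathcomp Require Import all_boot all_algebra.
From mathcomp Require Import boolp ring.

Set Implicit Arguments.
Unset Strict Implicit.
Unset Printing Implicit Defensive.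

Import GRing.Theory.
Local Open Scope ring_scope.
Local Open Scope quotient_scope.

(* Rings are [comPzRingType]s, so that the zero ring is allowed. *)

Record category := Category {
  obj :> Type;
  hom : obj -> obj -> Type;
  idm : forall A, hom A A;
  cmp : forall A B C, hom B C -> hom A B -> hom A C;
  cmp1m : forall A B (f : hom A B), cmp (idm B) f = f;
  cmpm1 : forall A B (f : hom A B), cmp f (idm A) = f;
  cmpA : forall A B C D (f : hom C D) (g : hom B C) (h : hom A B),
    cmp f (cmp g h) = cmp (cmp f g) h }.

Arguments hom {c} A B.
Arguments idm {c} A.
Arguments cmp {c A B C} f g.

Definition is_iso (C : category) (A B : C) (f : hom A B) : Prop :=
  exists f' : hom B A, cmp f' f = idm A /\ cmp f f' = idm B.

Record functor (C D : category) := Functor {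
  fobj :> C -> D;
  fmap : forall A B : C, hom A B -> hom (fobj A) (fobj B);
  fmap_id : forall A, fmap (idm A) = idm (fobj A);
  fmap_cmp : forall A B E (f : hom B E) (g : hom A B),
    fmap (cmp f g) = cmp (fmap f) (fmap g) }.

Arguments fmap {C D} F {A B} f : rename.

Definition idF (C : category) : functor C C :=
  @Functor C C id (fun _ _ f => f) (fun _ => erefl) (fun _ _ _ _ _ => erefl).

Section CompFunctor.
Variables (C D E : category) (G : functor D E) (F : functor C D).

Lemma compF_id A : fmap G (fmap F (idm A)) = idm (G (F A)).
Proof. by rewrite !fmap_id. Qed.

Lemma compF_cmp A B X (f : hom B X) (g : hom A B) :
  fmap G (fmap F (cmp f g)) = cmp (fmap G (fmap F f)) (fmap G (fmap F g)).
Proof. by rewrite !fmap_cmp. Qed.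

Definition compF : functor C E := Functor compF_id compF_cmp.

End CompFunctor.

Definition naturally_isomorphic (C D : category) (F G : functor C D) : Prop :=
  exists eta : forall A, hom (F A) (G A),
    (forall A B (f : hom A B), cmp (fmap G f) (eta A) = cmp (eta B) (fmap F f))
    /\ (forall A, is_iso (eta A)).

Section FullSubcategory.
Variables (C : category) (P : C -> Prop).

Definition full_subcategory : category :=
  @Category {A : C | P A} (fun A B => hom (sval A) (sval B))
    (fun A => idm (sval A)) (fun _ _ _ f g => cmp f g)
    (fun _ _ f => cmp1m f) (fun _ _ f => cmpm1 f)
    (fun _ _ _ _ f g h => cmpA f g h).

End FullSubcategory.

Definition restrictF (C D : category) (P : C -> Prop) (Q : D -> Prop)
    (F : functor C D) (FPQ : forall A, P A -> Q (F A)) :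
    functor (full_subcategory P) (full_subcategory Q) :=
  @Functor (full_subcategory P) (full_subcategory Q)
    (fun A => exist Q (F (sval A)) (FPQ _ (svalP A)))
    (fun _ _ f => fmap F f) (fun A => fmap_id F (sval A))
    (fun _ _ _ f g => fmap_cmp F f g).

Definition induce_inverse_equivalences (C D : category) (F : functor C D)
    (G : functor D C) (P : C -> Prop) (Q : D -> Prop) : Prop :=
  exists (FPQ : forall A, P A -> Q (F A)) (GQP : forall B, Q B -> P (G B)),
    naturally_isomorphic (compF (restrictF GQP) (restrictF FPQ))
                         (idF (full_subcategory P)) /\
    naturally_isomorphic (compF (restrictF FPQ) (restrictF GQP))
                         (idF (full_subcategory Q)).

Lemma linearP_ext (R : pzRingType) (U V : lmodType R) (f g : {linear U -> V}) :
  f =1 g -> f = g.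
Proof.
case: f g => [f [[fa] [fl]]] [g [[ga] [gl]]] /= /funext fg.
by subst g; rewrite (Prop_irrelevance fa ga) (Prop_irrelevance fl gl).
Qed.

Section ModCategory.
Variable R : pzRingType.

Definition mod_cmp (A B C : lmodType R) (f : {linear B -> C})
  (g : {linear A -> B}) : {linear A -> C} := f \o g.

Lemma mod_cmp1m (A B : lmodType R) (f : {linear A -> B}) : mod_cmp idfun f = f.
Proof. exact: linearP_ext. Qed.

Lemma mod_cmpm1 (A B : lmodType R) (f : {linear A -> B}) : mod_cmp f idfun = f.
Proof. exact: linearP_ext. Qed.

Lemma mod_cmpA (A B C D : lmodType R) (f : {linear C -> D}) (g : {linear B -> C})
  (h : {linear A -> B}) : mod_cmp f (mod_cmp g h) = mod_cmp (mod_cmp f g) h.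
Proof. exact: linearP_ext. Qed.

Definition Mod : category :=
  @Category (lmodType R) (fun U V => {linear U -> V}) (fun U => idfun)
    mod_cmp mod_cmp1m mod_cmpm1 mod_cmpA.

End ModCategory.

Definition no_torsion (R : pzRingType) (a : R) (M : lmodType R) : Prop :=
  injective (fun m : M => a *: m).

Definition finitely_generated (R : pzRingType) (M : lmodType R) : Prop :=
  exists (n : nat) (e : 'I_n -> M),
    forall m, exists c : 'I_n -> R, m = \sum_(i < n) c i *: e i.

Definition non_zero_divisor (R : comPzRingType) (a : R) : Prop :=
  forall b, a * b = 0 -> b = 0.

(* The pair (a, n) stands for the fraction a / x^n. *)
Section Localization.
Variables (R : comPzRingType) (x : R).
Implicit Types p q : R * nat.

Definition loc_rel p q : Prop :=
  exists k, x ^+ k * (x ^+ q.2 * p.1) = x ^+ k * (x ^+ p.2 * q.1).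

Definition loc_relb p q : bool := `[< loc_rel p q >].

Lemma loc_relb_refl : reflexive loc_relb.
Proof. by move=> p; apply/asboolP; exists 0. Qed.

Lemma loc_relb_sym : symmetric loc_relb.
Proof. by move=> p q; apply/asboolP/asboolP => -[k e]; exists k. Qed.

Lemma loc_relb_trans : transitive loc_relb.
Proof.
move=> [b m] [a n] [c p] /asboolP[k /= e1] /asboolP[l /= e2]; apply/asboolP.
exists (k + l + m)%N => /=; rewrite !exprD.
transitivity (x ^+ l * x ^+ p * (x ^+ k * (x ^+ m * a))); first by ring.
rewrite e1; transitivity (x ^+ k * x ^+ n * (x ^+ l * (x ^+ p * b))).
  by ring.
by rewrite e2; ring.
Qed.

Canonical loc_equiv :=
  EquivRel loc_relb loc_relb_refl loc_relb_sym loc_relb_trans.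

Definition loc : Type := {eq_quot loc_equiv}.
HB.instance Definition _ := Choice.on loc.

Definition frac (a : R) (n : nat) : loc := \pi_{eq_quot loc_equiv} (a, n).

Lemma fracP a n b m :
  frac a n = frac b m <->
  exists k, x ^+ k * (x ^+ m * a) = x ^+ k * (x ^+ n * b).
Proof.
split=> [/eqmodP/asboolP[k e]|[k e]]; first by exists k.
by apply/eqmodP/asboolP; exists k.
Qed.

Lemma frac_repr (u : loc) : u = frac (repr u).1 (repr u).2.
Proof. by rewrite /frac -surjective_pairing; exact/esym/reprK. Qed.

Lemma frac_ind (P : loc -> Prop) : (forall a n, P (frac a n)) -> forall u, P u.
Proof. by move=> h u; rewrite (frac_repr u). Qed.

Lemma repr_frac a n : exists k,
  x ^+ k * (x ^+ n * (repr (frac a n)).1) =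
  x ^+ k * (x ^+ (repr (frac a n)).2 * a).
Proof. by apply/fracP; rewrite -frac_repr. Qed.

Definition loc_add (u v : loc) : loc :=
  let p := repr u in let q := repr v in
  frac (x ^+ q.2 * p.1 + x ^+ p.2 * q.1) (p.2 + q.2).
Definition loc_opp (u : loc) : loc := frac (- (repr u).1) (repr u).2.
Definition loc_mul (u v : loc) : loc :=
  frac ((repr u).1 * (repr v).1) ((repr u).2 + (repr v).2).

Lemma loc_addE a n b m :
  loc_add (frac a n) (frac b m) = frac (x ^+ m * a + x ^+ n * b) (n + m).
Proof.
have [k] := repr_frac a n; have [l] := repr_frac b m; rewrite /loc_add.
case: (repr (frac a n)) (repr (frac b m)) => [a' n'] [b' m'] /= e2 e1.
apply/fracP; exists (k + l)%N; rewrite !exprD.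
transitivity (x ^+ l * x ^+ m' * x ^+ m * (x ^+ k * (x ^+ n * a')) +
              x ^+ k * x ^+ n' * x ^+ n * (x ^+ l * (x ^+ m * b'))).
  by ring.
by rewrite e1 e2; ring.
Qed.

Lemma loc_oppE a n : loc_opp (frac a n) = frac (- a) n.
Proof.
have [k] := repr_frac a n; rewrite /loc_opp.
case: (repr (frac a n)) => [a' n'] /= e; apply/fracP; exists k.
by rewrite !mulrN e.
Qed.

Lemma loc_mulE a n b m :
  loc_mul (frac a n) (frac b m) = frac (a * b) (n + m).
Proof.
have [k] := repr_frac a n; have [l] := repr_frac b m; rewrite /loc_mul.
case: (repr (frac a n)) (repr (frac b m)) => [a' n'] [b' m'] /= e2 e1.
apply/fracP; exists (k + l)%N; rewrite !exprD.
transitivity ((x ^+ k * (x ^+ n * a')) * (x ^+ l * (x ^+ m * b'))); first by ring.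
by rewrite e1 e2; ring.
Qed.

Lemma loc_addA : associative loc_add.
Proof.
elim/frac_ind => a n; elim/frac_ind => b m; elim/frac_ind => c p.
by rewrite !loc_addE; apply/fracP; exists 0; rewrite !exprD; ring.
Qed.

Lemma loc_addC : commutative loc_add.
Proof.
elim/frac_ind => a n; elim/frac_ind => b m.
by rewrite !loc_addE; apply/fracP; exists 0; rewrite !exprD; ring.
Qed.

Lemma loc_add0 : left_id (frac 0 0) loc_add.
Proof.
elim/frac_ind => a n; rewrite !loc_addE; apply/fracP; exists 0.
by rewrite !exprD; ring.
Qed.

Lemma loc_addN : left_inverse (frac 0 0) loc_opp loc_add.
Proof.
elim/frac_ind => a n; rewrite loc_oppE loc_addE; apply/fracP; exists 0.
by rewrite !exprD; ring.
Qed.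

HB.instance Definition _ :=
  GRing.isZmodule.Build loc loc_addA loc_addC loc_add0 loc_addN.

Lemma loc_mulA : associative loc_mul.
Proof.
elim/frac_ind => a n; elim/frac_ind => b m; elim/frac_ind => c p.
by rewrite !loc_mulE mulrA addnA.
Qed.

Lemma loc_mulC : commutative loc_mul.
Proof.
elim/frac_ind => a n; elim/frac_ind => b m.
by rewrite !loc_mulE mulrC addnC.
Qed.

Lemma loc_mul1 : left_id (frac 1 0) loc_mul.
Proof. by elim/frac_ind => a n; rewrite !loc_mulE mul1r. Qed.

Lemma loc_mulD : left_distributive loc_mul loc_add.
Proof.
elim/frac_ind => a n; elim/frac_ind => b m; elim/frac_ind => c p.
rewrite loc_addE !loc_mulE loc_addE; apply/fracP; exists 0.
by rewrite !exprD; ring.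
Qed.

HB.instance Definition _ := GRing.Zmodule_isComPzRing.Build loc
  loc_mulA loc_mulC loc_mul1 loc_mulD.

Lemma fracD a n b m :
  frac a n + frac b m = frac (x ^+ m * a + x ^+ n * b) (n + m).
Proof. exact: loc_addE. Qed.

Lemma fracN a n : - frac a n = frac (- a) n.
Proof. exact: loc_oppE. Qed.

Lemma fracM a n b m : frac a n * frac b m = frac (a * b) (n + m).
Proof. exact: loc_mulE. Qed.

Definition to_loc (a : R) : loc := frac a 0.

Lemma to_loc_zmod : zmod_morphism to_loc.
Proof. by move=> a b; rewrite /to_loc fracN fracD !expr0 !mul1r. Qed.

Lemma to_loc_monoid : monoid_morphism to_loc.
Proof. by split=> // a b; rewrite /to_loc fracM. Qed.

HB.instance Definition _ := GRing.isZmodMorphism.Build R loc to_loc to_loc_zmod.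
HB.instance Definition _ :=
  GRing.isMonoidMorphism.Build R loc to_loc to_loc_monoid.

End Localization.

Section LocalizationMap.
Variables (R R' : comPzRingType) (g : {rmorphism R -> R'}) (x : R).

Definition loc_map (u : loc x) : loc (g x) :=
  frac (g x) (g (repr u).1) (repr u).2.

Lemma loc_mapE a n : loc_map (frac x a n) = frac (g x) (g a) n.
Proof.
have [k] := repr_frac x a n; rewrite /loc_map.
case: (repr (frac x a n)) => [a' n'] /= e; apply/fracP; exists k.
by rewrite -!rmorphXn -!rmorphM e.
Qed.

Lemma loc_map_zmod : zmod_morphism loc_map.
Proof.
elim/frac_ind => a n; elim/frac_ind => b m.
by rewrite fracN fracD !loc_mapE fracN fracD rmorphD !rmorphM !rmorphXn rmorphN.
Qed.

Lemma loc_map_monoid : monoid_morphism loc_map.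
Proof.
split; first by rewrite /= loc_mapE rmorph1.
elim/frac_ind => a n; elim/frac_ind => b m.
by rewrite fracM !loc_mapE fracM rmorphM.
Qed.

HB.instance Definition _ :=
  GRing.isZmodMorphism.Build (loc x) (loc (g x)) loc_map loc_map_zmod.
HB.instance Definition _ :=
  GRing.isMonoidMorphism.Build (loc x) (loc (g x)) loc_map loc_map_monoid.

End LocalizationMap.

(* [tensor g M] is M (x)_R S, where S is an R-module via g : R -> S. A list of
   pairs (m, s) stands for the sum of the elementary tensors m (x) s, and
   [tens_rel] is the congruence generated by the bilinearity relations. The
   quotient is a group since -(m (x) s) = (-m) (x) s. *)
Section Tensor.
Variables (R S : comPzRingType) (g : {rmorphism R -> S}) (M : lmodType R).

Inductive tens_rel : seq (M * S) -> seq (M * S) -> Prop :=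
| TensRefl a : tens_rel a a
| TensSym a b : tens_rel a b -> tens_rel b a
| TensTrans a b c : tens_rel a b -> tens_rel b c -> tens_rel a c
| TensCat a b c d :
    tens_rel a b -> tens_rel c d -> tens_rel (a ++ c) (b ++ d)
| TensC a b : tens_rel (a ++ b) (b ++ a)
| Tens0 s : tens_rel [:: (0, s)] [::]
| TensDl m m' s : tens_rel [:: (m + m', s)] [:: (m, s); (m', s)]
| TensDr m s s' : tens_rel [:: (m, s + s')] [:: (m, s); (m, s')]
| TensZ r m s : tens_rel [:: (r *: m, s)] [:: (m, g r * s)].

Definition tens_relb a b : bool := `[< tens_rel a b >].

Lemma tens_relb_refl : reflexive tens_relb.
Proof. by move=> a; apply/asboolP; exact: TensRefl. Qed.

Lemma tens_relb_sym : symmetric tens_relb.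
Proof. by move=> a b; apply/asboolP/asboolP; exact: TensSym. Qed.

Lemma tens_relb_trans : transitive tens_relb.
Proof.
move=> b a c /asboolP ab /asboolP bc; apply/asboolP; exact: TensTrans ab bc.
Qed.

Canonical tens_equiv :=
  EquivRel tens_relb tens_relb_refl tens_relb_sym tens_relb_trans.

Definition tensor : Type := {eq_quot tens_equiv}.
HB.instance Definition _ := Choice.on tensor.

Definition tens_class (a : seq (M * S)) : tensor := \pi_{eq_quot tens_equiv} a.

Lemma tens_classP a b : tens_class a = tens_class b <-> tens_rel a b.
Proof. by split=> [/eqmodP/asboolP|e] //; apply/eqmodP/asboolP. Qed.

Lemma tens_repr (u : tensor) : u = tens_class (repr u).
Proof. exact/esym/reprK. Qed.

Lemma repr_tens a : tens_rel (repr (tens_class a)) a.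
Proof. by apply/tens_classP; rewrite -tens_repr. Qed.

Lemma tens_class_ind (P : tensor -> Prop) :
  (forall a, P (tens_class a)) -> forall u, P u.
Proof. by move=> h u; rewrite (tens_repr u). Qed.

Definition tens_add (u v : tensor) : tensor := tens_class (repr u ++ repr v).

Lemma tens_addE a b : tens_add (tens_class a) (tens_class b) = tens_class (a ++ b).
Proof. by apply/tens_classP; apply: TensCat; exact: repr_tens. Qed.

Lemma tens_addA : associative tens_add.
Proof. by do 3!elim/tens_class_ind => ?; rewrite !tens_addE catA. Qed.

Lemma tens_addC : commutative tens_add.
Proof. by do 2!elim/tens_class_ind => ?; rewrite !tens_addE; apply/tens_classP/TensC. Qed.

Lemma tens_add0 : left_id (tens_class [::]) tens_add.
Proof. by elim/tens_class_ind => a; rewrite tens_addE. Qed.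

Definition tens_scale_seq (t : S) (a : seq (M * S)) :=
  [seq (p.1, t * p.2) | p <- a].

Lemma tens_scale_rel t a b :
  tens_rel a b -> tens_rel (tens_scale_seq t a) (tens_scale_seq t b).
Proof.
rewrite /tens_scale_seq.
elim=> {a b} /= [a|a b _ /TensSym //|a b c _ h1 _ h2|a b c d _ h1 _ h2|a b|s
  |m m' s|m s s'|r m s].
- exact: TensRefl.
- exact: TensTrans h1 h2.
- by rewrite !map_cat; exact: TensCat.
- by rewrite !map_cat; exact: TensC.
- exact: Tens0.
- exact: TensDl.
- by rewrite mulrDr; exact: TensDr.
- by rewrite mulrCA; exact: TensZ.
Qed.

Definition tens_scale (t : S) (u : tensor) : tensor :=
  tens_class (tens_scale_seq t (repr u)).

Lemma tens_scaleE t a :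
  tens_scale t (tens_class a) = tens_class (tens_scale_seq t a).
Proof. by apply/tens_classP/tens_scale_rel/repr_tens. Qed.

Definition tens_opp (u : tensor) : tensor := tens_scale (-1) u.

Lemma tens_scale0 a : tens_rel (tens_scale_seq 0 a) [::].
Proof.
elim: a => [|[m s] a ih] /=; first exact: TensRefl.
rewrite -cat1s -[X in tens_rel _ X]cat0s; apply: TensCat => //.
rewrite mul0r -(mul0r 0) -[in X in tens_rel [:: (_, X * _)] _](rmorph0 g).
by apply: TensTrans (Tens0 0); rewrite -(scale0r m); apply/TensSym/TensZ.
Qed.

Lemma tens_scaleDl t t' a :
  tens_rel (tens_scale_seq (t + t') a)
           (tens_scale_seq t a ++ tens_scale_seq t' a).
Proof.
elim: a => [|[m s] a ih] /=; first exact: TensRefl.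
rewrite mulrDl -cat1s.
apply: (TensTrans (TensCat (TensDr _ _ _) ih)).
set A := tens_scale_seq t a; set B := tens_scale_seq t' a.
apply: (@TensCat [:: (m, t * s)] [:: (m, t * s)] ((_ :: A) ++ B) (A ++ _ :: B)).
  exact: TensRefl.
rewrite -[in X in tens_rel _ X]cat1s catA; apply: TensCat; last exact: TensRefl.
exact: (TensC [:: _] A).
Qed.

Lemma tens_scale1 a : tens_scale_seq 1 a = a.
Proof.
by rewrite /tens_scale_seq -[RHS]map_id; apply: eq_map => -[m s] /=; rewrite mul1r.
Qed.

Lemma tens_addN : left_inverse (tens_class [::]) tens_opp tens_add.
Proof.
elim/tens_class_ind => a; rewrite /tens_opp tens_scaleE tens_addE.
apply/tens_classP; rewrite -[X in _ ++ X]tens_scale1.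
by apply: TensTrans (tens_scale0 a); rewrite -(addNr 1); apply/TensSym/tens_scaleDl.
Qed.

HB.instance Definition _ :=
  GRing.isZmodule.Build tensor tens_addA tens_addC tens_add0 tens_addN.

Lemma tens_classD a b : tens_class a + tens_class b = tens_class (a ++ b).
Proof. exact: tens_addE. Qed.

Lemma tens_scaleA a b v : tens_scale a (tens_scale b v) = tens_scale (a * b) v.
Proof.
elim/tens_class_ind: v => v; rewrite !tens_scaleE /tens_scale_seq -map_comp.
by congr tens_class; apply: eq_map => -[m s] /=; rewrite mulrA.
Qed.

Lemma tens_scale1r : left_id 1 tens_scale.
Proof. by elim/tens_class_ind => v; rewrite tens_scaleE tens_scale1. Qed.

Lemma tens_scaleDr : right_distributive tens_scale +%R.
Proof.
move=> t; do 2!elim/tens_class_ind => ?.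
by rewrite tens_classD !tens_scaleE tens_classD /tens_scale_seq map_cat.
Qed.

Lemma tens_scalerDl v : {morph tens_scale^~ v : a b / a + b}.
Proof.
elim/tens_class_ind: v => v a b /=.
by rewrite !tens_scaleE tens_classD; apply/tens_classP/tens_scaleDl.
Qed.

HB.instance Definition _ := GRing.Zmodule_isLmodule.Build S tensor
  tens_scaleA tens_scale1r tens_scaleDr tens_scalerDl.

Definition tens (m : M) (s : S) : tensor := tens_class [:: (m, s)].

Lemma tensDl m m' s : tens (m + m') s = tens m s + tens m' s.
Proof. by rewrite tens_classD; apply/tens_classP/TensDl. Qed.

Lemma tensDr m s s' : tens m (s + s') = tens m s + tens m s'.
Proof. by rewrite tens_classD; apply/tens_classP/TensDr. Qed.

Lemma tensZl r m s : tens (r *: m) s = tens m (g r * s).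
Proof. by apply/tens_classP/TensZ. Qed.

Lemma tensZr t m s : t *: tens m s = tens m (t * s).
Proof. exact: tens_scaleE. Qed.

Lemma tens0 s : tens 0 s = 0.
Proof. exact/tens_classP/Tens0. Qed.

Lemma tens_ind (P : tensor -> Prop) :
  P 0 -> (forall u v, P u -> P v -> P (u + v)) -> (forall m s, P (tens m s)) ->
  forall u, P u.
Proof.
move=> P0 PD Pt; elim/tens_class_ind; elim=> [|[m s] a ih] //.
by rewrite -cat1s -tens_classD; exact: PD (Pt m s) ih.
Qed.

Definition tens1 (m : M) : tensor := tens m 1.

Lemma tens1_linear : linear_for (g \; *:%R) tens1.
Proof.
by move=> r m m'; rewrite /tens1 tensDl tensZl /= tensZr.
Qed.

HB.instance Definition _ := GRing.isLinear.Build R M tensor _ tens1 tens1_linear.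

Lemma tensor_ext (N : lmodType S) (f f' : {linear tensor -> N}) :
  (forall m, f (tens m 1) = f' (tens m 1)) -> f =1 f'.
Proof.
move=> e; elim/tens_ind => [|u v eu ev|m s]; rewrite ?raddf0 //.
  by rewrite !linearD /= eu ev.
by rewrite -[s]mulr1 -tensZr !linearZ_LR e.
Qed.

Section Lift.
Variables (N : lmodType S) (f : {linear M -> N | g \; *:%R}).

Definition tens_lift_seq (a : seq (M * S)) : N := \sum_(p <- a) p.2 *: f p.1.

Lemma tens_lift_rel a b : tens_rel a b -> tens_lift_seq a = tens_lift_seq b.
Proof.
rewrite /tens_lift_seq.
elim=> {a b} /= [a|a b _ -> //|a b c _ -> _ -> //|a b c d _ h1 _ h2|a b|s
  |m m' s|m s s'|r m s]; rewrite ?big_cat ?big_cons ?big_nil ?addr0 //=.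
- by rewrite h1 h2.
- exact: addrC.
- by rewrite raddf0 scaler0.
- by rewrite raddfD scalerDr.
- by rewrite scalerDl.
- by rewrite linearZ /= scalerA mulrC.
Qed.

Definition tens_lift (u : tensor) : N := tens_lift_seq (repr u).

Lemma tens_lift_class a : tens_lift (tens_class a) = tens_lift_seq a.
Proof. exact/tens_lift_rel/repr_tens. Qed.

Lemma tens_lift_linear : linear tens_lift.
Proof.
move=> t; do 2!elim/tens_class_ind => ?.
rewrite [_ *: _]tens_scaleE tens_classD.
rewrite !tens_lift_class /tens_lift_seq.
rewrite big_cat big_map /= scaler_sumr; congr (_ + _).
by apply: eq_bigr => p _; rewrite scalerA.
Qed.

HB.instance Definition _ :=
  GRing.isLinear.Build S tensor N _ tens_lift tens_lift_linear.

Lemma tens_liftE m s : tens_lift (tens m s) = s *: f m.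
Proof. by rewrite tens_lift_class /tens_lift_seq big_seq1. Qed.

End Lift.

End Tensor.

Definition restr (R S : comPzRingType) (g : {rmorphism R -> S})
  (N : lmodType S) : Type := N.

Section RestrictScalars.
Variables (R S : comPzRingType) (g : {rmorphism R -> S}) (N : lmodType S).

Local Notation restr := (restr g N).

HB.instance Definition _ := GRing.Zmodule.copy restr N.

Definition restr_scale (r : R) (v : restr) : restr := g r *: (v : N).

Lemma restr_scaleA a b v : restr_scale a (restr_scale b v) = restr_scale (a * b) v.
Proof. by rewrite /restr_scale scalerA rmorphM. Qed.

Lemma restr_scale1 : left_id 1 restr_scale.
Proof. by move=> v; rewrite /restr_scale rmorph1 scale1r. Qed.

Lemma restr_scaleDr : right_distributive restr_scale +%R.
Proof. by move=> a u v; exact: scalerDr. Qed.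

Lemma restr_scaleDl v : {morph restr_scale^~ v : a b / a + b}.
Proof. by move=> a b; rewrite /restr_scale rmorphD scalerDl. Qed.

HB.instance Definition _ := GRing.Zmodule_isLmodule.Build R restr
  restr_scaleA restr_scale1 restr_scaleDr restr_scaleDl.

Lemma restr_scaleE (r : R) (v : restr) : r *: v = g r *: (v : N).
Proof. by []. Qed.

End RestrictScalars.

Section TensMap.
Variables (R S : comPzRingType) (g : {rmorphism R -> S}).

(* f (x) 1 *)
Definition tens_map (M N : lmodType R) (f : {linear M -> N}) :
  {linear tensor g M -> tensor g N} := tens_lift (@tens1 R S g N \o f).

Lemma tens_mapE (M N : lmodType R) (f : {linear M -> N}) m s :
  tens_map f (tens g m s) = tens g (f m) s.
Proof. by rewrite /tens_map /= tens_liftE /= /tens1 tensZr mulr1. Qed.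

Lemma tens_map_id (M : lmodType R) : tens_map (@idfun M) =1 id.
Proof. by apply: (@tensor_ext _ _ _ _ _ _ idfun) => m; rewrite tens_mapE. Qed.

Lemma tens_map_comp (L M N : lmodType R) (f : {linear M -> N})
    (f' : {linear L -> M}) :
  tens_map (f \o f') =1 tens_map f \o tens_map f'.
Proof. by apply: tensor_ext => m; rewrite /= !tens_mapE. Qed.

End TensMap.

(* The canonical isomorphism (M (x)_R R1) (x)_R1 S = M (x)_R S, where k = h g. *)
Section Associativity.
Variables (R R1 S : comPzRingType) (g : {rmorphism R -> R1}).
Variables (h : {rmorphism R1 -> S}) (k : {rmorphism R -> S}).
Hypothesis hgk : h \o g =1 k.
Variable M : lmodType R.

Definition assoc_in (m : M) : restr h (tensor k M) := tens k m 1.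

Lemma assoc_in_linear : linear_for (g \; *:%R) assoc_in.
Proof.
move=> r m m'; rewrite /assoc_in tensDl tensZl /= restr_scaleE tensZr.
by rewrite -hgk.
Qed.

HB.instance Definition _ := GRing.isLinear.Build R M (restr h (tensor k M)) _
  assoc_in assoc_in_linear.

Definition assoc_mid (u : tensor g M) : tensor k M := tens_lift assoc_in u.

Lemma assoc_mid_linear : linear_for (h \; *:%R) assoc_mid.
Proof. by move=> r u v; rewrite /assoc_mid linearP. Qed.

HB.instance Definition _ := GRing.isLinear.Build R1 (tensor g M) (tensor k M) _
  assoc_mid assoc_mid_linear.

(* (m (x) a) (x) s |-> m (x) (h a * s) *)
Definition assoc : {linear tensor h (tensor g M) -> tensor k M} :=
  tens_lift assoc_mid.

Lemma assocE m a s : assoc (tens h (tens g m a) s) = tens k m (h a * s).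
Proof.
rewrite /assoc /= tens_liftE /= /assoc_mid /= tens_liftE /= restr_scaleE /assoc_in.
by rewrite !tensZr mulr1 mulrC.
Qed.

Definition assoc_inv_in (m : M) : tensor h (tensor g M) := tens h (tens g m 1) 1.

Lemma assoc_inv_in_linear : linear_for (k \; *:%R) assoc_inv_in.
Proof.
move=> r m m'; rewrite /assoc_inv_in !tensDl tensZl -tensZr tensZl /= tensZr.
by rewrite -hgk.
Qed.

HB.instance Definition _ := GRing.isLinear.Build R M (tensor h (tensor g M)) _
  assoc_inv_in assoc_inv_in_linear.

(* m (x) s |-> (m (x) 1) (x) s *)
Definition assoc_inv : {linear tensor k M -> tensor h (tensor g M)} :=
  tens_lift assoc_inv_in.

Lemma assoc_invE m s : assoc_inv (tens k m s) = tens h (tens g m 1) s.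
Proof. by rewrite /assoc_inv /= tens_liftE /= /assoc_inv_in tensZr mulr1. Qed.

Lemma assoc_invK : cancel assoc_inv assoc.
Proof.
apply: (@tensor_ext _ _ _ _ _ (assoc \o assoc_inv) idfun) => m /=.
by rewrite assoc_invE assocE rmorph1 mul1r.
Qed.

Lemma assocK : cancel assoc assoc_inv.
Proof.
apply: (@tensor_ext _ _ _ _ _ (assoc_inv \o assoc) idfun) => u /=.
elim/tens_ind: u => [|u v eu ev|m s].
- by rewrite tens0 !linear0.
- by rewrite tensDl !linearD /= eu ev.
- rewrite assocE assoc_invE mulr1 -[s in RHS]mulr1 -tensZr tensZl.
  by rewrite mulr1.
Qed.

End Associativity.

Record square := Square {
  sqR : comPzRingType;
  sqR1 : comPzRingType;
  sqR2 : comPzRingType;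
  sqS : comPzRingType;
  sqg1 : {rmorphism sqR -> sqR1};
  sqg2 : {rmorphism sqR -> sqR2};
  sqh1 : {rmorphism sqR1 -> sqS};
  sqh2 : {rmorphism sqR2 -> sqS};
  sq_comm : sqh1 \o sqg1 =1 sqh2 \o sqg2 }.

Section Square.
Variable Q : square.

Definition sq_phi (r : sqR Q) : sqR1 Q * sqR2 Q := (sqg1 Q r, sqg2 Q r).
Definition sq_psi (p : sqR1 Q * sqR2 Q) : sqS Q := sqh1 Q p.1 - sqh2 Q p.2.

Definition cartesian : Prop :=
  injective sq_phi /\ (forall p, sq_psi p = 0 <-> exists r, sq_phi r = p).

Definition surjective_square : Prop := forall s, exists p, sq_psi p = s.

Record patching_datum := PatchingDatum {
  pdM1 : lmodType (sqR1 Q);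
  pdM2 : lmodType (sqR2 Q);
  pd_iso : {linear tensor (sqh1 Q) pdM1 -> tensor (sqh2 Q) pdM2};
  pd_isoP : bijective pd_iso }.

Record pd_hom (X Y : patching_datum) := PDHom {
  pdf1 : {linear pdM1 X -> pdM1 Y};
  pdf2 : {linear pdM2 X -> pdM2 Y};
  pdfP : pd_iso Y \o tens_map (sqh1 Q) pdf1 =1 tens_map (sqh2 Q) pdf2 \o pd_iso X }.

Lemma pd_hom_ext X Y (f f' : pd_hom X Y) :
  pdf1 f = pdf1 f' -> pdf2 f = pdf2 f' -> f = f'.
Proof.
case: f f' => [f1 f2 fP] [f1' f2' fP'] /= e1 e2.
by subst; congr PDHom; exact: Prop_irrelevance.
Qed.

Lemma pd_id_subproof (X : patching_datum) :
  pd_iso X \o tens_map (sqh1 Q) idfun =1 tens_map (sqh2 Q) idfun \o pd_iso X.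
Proof. by move=> u; rewrite /= !tens_map_id. Qed.

Definition pd_id X : pd_hom X X := PDHom (@pd_id_subproof X).

Lemma pd_cmp_subproof X Y Z (f : pd_hom Y Z) (f' : pd_hom X Y) :
  pd_iso Z \o tens_map (sqh1 Q) (pdf1 f \o pdf1 f') =1
  tens_map (sqh2 Q) (pdf2 f \o pdf2 f') \o pd_iso X.
Proof.
move=> u; have eY := pdfP f; have eX := pdfP f'; rewrite /= !tens_map_comp /=.
by rewrite -[RHS]/(_ ((tens_map _ _ \o pd_iso X) u)) -eX /= -[RHS]eY.
Qed.

Definition pd_cmp X Y Z (f : pd_hom Y Z) (f' : pd_hom X Y) : pd_hom X Z :=
  PDHom (pd_cmp_subproof f f').

Lemma pd_cmp1m X Y (f : pd_hom X Y) : pd_cmp (pd_id Y) f = f.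
Proof. by apply: pd_hom_ext; exact: linearP_ext. Qed.

Lemma pd_cmpm1 X Y (f : pd_hom X Y) : pd_cmp f (pd_id X) = f.
Proof. by apply: pd_hom_ext; exact: linearP_ext. Qed.

Lemma pd_cmpA W X Y Z (f : pd_hom Y Z) (f' : pd_hom X Y) (f'' : pd_hom W X) :
  pd_cmp f (pd_cmp f' f'') = pd_cmp (pd_cmp f f') f''.
Proof. by apply: pd_hom_ext; exact: linearP_ext. Qed.

Definition PD : category := Category pd_cmp1m pd_cmpm1 pd_cmpA.

Section FObject.
Variable M : lmodType (sqR Q).

Definition sq_diag : {rmorphism sqR Q -> sqS Q} := sqh2 Q \o sqg2 Q.

(* Both iterated tensor products are canonically M (x)_R S; under these
   identifications the following map is the identity of M (x)_R S. *)
Definition F_iso : {linear tensor (sqh1 Q) (tensor (sqg1 Q) M) ->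
                           tensor (sqh2 Q) (tensor (sqg2 Q) M)} :=
  assoc_inv (k := sq_diag) (frefl _) M \o assoc (k := sq_diag) (@sq_comm Q) M.

Lemma F_isoP : bijective F_iso.
Proof.
exists (assoc_inv (@sq_comm Q) M \o assoc (k := sq_diag) (frefl _) M) => u /=.
  by rewrite assoc_invK assocK.
by rewrite assoc_invK assocK.
Qed.

Definition F_obj : patching_datum := PatchingDatum F_isoP.

End FObject.

Lemma F_map_subproof (M N : lmodType (sqR Q)) (f : {linear M -> N}) :
  F_iso N \o tens_map (sqh1 Q) (tens_map (sqg1 Q) f) =1
  tens_map (sqh2 Q) (tens_map (sqg2 Q) f) \o F_iso M.
Proof.
apply: tensor_ext => /= u; elim/tens_ind: u => [|u v eu ev|m s].
- by rewrite tens0 !linear0.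
- by rewrite tensDl !linearD /= eu ev.
- by rewrite !tens_mapE !assocE !assoc_invE !tens_mapE.
Qed.

Definition F_map (M N : lmodType (sqR Q)) (f : {linear M -> N}) :
    pd_hom (F_obj M) (F_obj N) :=
  @PDHom (F_obj M) (F_obj N) (tens_map (sqg1 Q) f) (tens_map (sqg2 Q) f)
    (F_map_subproof f).

Lemma F_map_id (M : lmodType (sqR Q)) : F_map (@idfun M) = pd_id (F_obj M).
Proof. by apply: pd_hom_ext; apply: linearP_ext => u; exact: tens_map_id. Qed.

Lemma F_map_cmp (L M N : lmodType (sqR Q)) (f : {linear M -> N})
    (f' : {linear L -> M}) :
  F_map (mod_cmp f f') = pd_cmp (F_map f) (F_map f').
Proof. by apply: pd_hom_ext; apply: linearP_ext => u; exact: tens_map_comp. Qed.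

Definition functorF : functor (Mod (sqR Q)) PD :=
  @Functor (Mod (sqR Q)) PD F_obj F_map F_map_id F_map_cmp.

Section GObject.
Variable X : patching_datum.

Notation M12 := (restr (sqg1 Q) (pdM1 X) * restr (sqg2 Q) (pdM2 X))%type.

Definition G_pred (p : M12) : bool :=
  `[< pd_iso X (tens (sqh1 Q) (p.1 : pdM1 X) 1) = tens (sqh2 Q) (p.2 : pdM2 X) 1 >].

Record G_type := GType { G_val : M12; _ : G_pred G_val }.

HB.instance Definition _ := [isSub for G_val].
HB.instance Definition _ := [Choice of G_type by <:].

Lemma G_closed : GRing.subsemimod_closed G_pred.
Proof.
split; first split.
- by apply/asboolP; rewrite !tens0 linear0.
- move=> p q /asboolP ep /asboolP eq; apply/asboolP.
  by rewrite !tensDl linearD /= ep eq.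
- move=> r p /asboolP ep; apply/asboolP.
  rewrite /= !restr_scaleE !tensZl -!tensZr linearZ /= ep.
  by rewrite -[_ (sqg1 Q r)]/((sqh1 Q \o sqg1 Q) r) sq_comm.
Qed.

HB.instance Definition _ := GRing.SubChoice_isSubLmodule.Build
  (sqR Q) M12 G_pred G_type G_closed.

End GObject.

Section GMap.
Variables (X Y : patching_datum) (f : pd_hom X Y).

Lemma G_map_subproof (p : G_type X) :
  G_pred (X := Y) (pdf1 f (val p).1, pdf2 f (val p).2).
Proof.
apply/asboolP; rewrite /= -!tens_mapE.
rewrite -[LHS]/((pd_iso Y \o tens_map (sqh1 Q) (pdf1 f)) _) pdfP /=.
by have /asboolP -> := valP p.
Qed.

Definition G_map_fun (p : G_type X) : G_type Y := GType (G_map_subproof p).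

Lemma G_map_linear : linear G_map_fun.
Proof.
move=> r p q; apply: val_inj; rewrite linearP /=.
by congr pair; rewrite /= linearP.
Qed.

HB.instance Definition _ := GRing.isLinear.Build (sqR Q) (G_type X) (G_type Y) _
  G_map_fun G_map_linear.

Definition G_map : {linear G_type X -> G_type Y} := G_map_fun.

End GMap.

Lemma G_map_id (X : patching_datum) : G_map (pd_id X) = idfun.
Proof.
by apply: linearP_ext => p; apply: val_inj; rewrite /= -surjective_pairing.
Qed.

Lemma G_map_cmp (X Y Z : patching_datum) (f : pd_hom Y Z) (f' : pd_hom X Y) :
  G_map (pd_cmp f f') = mod_cmp (G_map f) (G_map f').
Proof. by apply: linearP_ext => p; exact: val_inj. Qed.

Definition functorG : functor PD (Mod (sqR Q)) :=
  @Functor PD (Mod (sqR Q)) G_type G_map G_map_id G_map_cmp.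

End Square.

Section LocSquare.
Variables (R R' : comPzRingType) (g : {rmorphism R -> R'}) (x : R).

Lemma loc_square_comm : @loc_map R R' g x \o to_loc x =1 to_loc (g x) \o g.
Proof. by move=> a; rewrite /= loc_mapE. Qed.

Definition loc_square : square := Square loc_square_comm.

Definition mod_no_torsion (M : Mod R) : Prop := no_torsion x M.

Definition mod_fg_no_torsion (M : Mod R) : Prop :=
  finitely_generated M /\ no_torsion x M.

Definition pd_no_torsion (X : PD loc_square) : Prop :=
  no_torsion (to_loc x x) (pdM1 X) /\ no_torsion (g x) (pdM2 X).

Definition pd_fg_no_torsion (X : PD loc_square) : Prop :=
  (finitely_generated (pdM1 X) /\ no_torsion (to_loc x x) (pdM1 X)) /\
  (finitely_generated (pdM2 X) /\ no_torsion (g x) (pdM2 X)).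

End LocSquare.

(* Main.v *)
From HB Require Import structures.
Require Import Defs.
From mathcomp Require Import all_boot all_algebra.
From mathcomp Require Import boolp ring.

(* Write A for the fibre product of R1 and R2 over S, so that G(F(R)) = A.
   - Cartesian: if R is isomorphic to A as an R-module then A = R e; writing
     1 = r e and e^2 = t e gives e = r e^2 = r t e = t, so e comes from R and
     so does all of A.
   - Surjective: for s in S glue R1^2 and R2^2 along the shear matrix
     (1 s; 0 1), giving a datum X with a projection f : X -> F(R) onto the
     second coordinate. Composing G(f) with an isomorphism from G(F(R)) to R
     gives p : G(X) -> R, with image an ideal I. By naturality of FG = id,
     I (x) R1 -> R1 and I (x) R2 -> R2 are surjective. The first one puts a
     power of x in I; as I (x) R2 has no x-torsion, the second one is then
     injective. Hence G(F(I)) -> G(F(R)) is surjective and GF = id gives I = R.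
     So (1, 1) in A is G(f) of some ((a1, 1), (b1, 1)), that is
     a1 + s = b1 in S. *)

Set Implicit Arguments.
Unset Strict Implicit.
Unset Printing Implicit Defensive.
Import GRing.Theory.
Local Open Scope ring_scope.


(** * The identification of R (x)_R S with S *)

Lemma tens0r (R S : comPzRingType) (k : {rmorphism R -> S}) (M : lmodType R)
  (m : M) : tens k m 0 = 0.
Proof. by rewrite -(scale0r (0 : S^o)) -tensZr scale0r. Qed.

Section RegularTensor.
Variables (R S : comPzRingType) (k : {rmorphism R -> S}).

Definition reg_in (r : R^o) : S^o := k r.

Lemma reg_in_linear : linear_for (k \; *:%R) reg_in.
Proof. by move=> a r r'; rewrite /reg_in rmorphD rmorphM. Qed.

HB.instance Definition _ := GRing.isLinear.Build R R^o S^o _ reg_in reg_in_linear.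

(** The canonical isomorphism r (x) t |-> k(r) t, with inverse t |-> 1 (x) t. *)
Definition reg : {linear tensor k R^o -> S^o} := tens_lift reg_in.

Lemma regE r t : reg (tens k (r : R^o) t) = k r * t.
Proof. by rewrite /reg /= tens_liftE /= mulrC. Qed.

Lemma regK u : tens k (1 : R^o) (reg u) = u.
Proof.
elim/tens_ind: u => [|u v eu ev|r t].
- by rewrite linear0 tens0r.
- by rewrite linearD tensDr eu ev.
- by rewrite regE -tensZl; congr tens; exact: mulr1.
Qed.

Lemma reg_inj : injective reg.
Proof. exact: can_inj regK. Qed.

End RegularTensor.

Section TensTensor.
Variables (R R1 S : comPzRingType) (g : {rmorphism R -> R1}).
Variable h : {rmorphism R1 -> S}.

Lemma tens_tens1 (a : R1) :
  tens h (tens g (1 : R^o) a) 1 = tens h (tens g (1 : R^o) 1) (h a).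
Proof. by rewrite -{1}[a]mulr1 -tensZr tensZl mulr1. Qed.

(** The associativity isomorphism followed by [reg] recovers [s]. *)
Lemma tens_tens1_inj :
  injective (fun s => tens h (tens g (1 : R^o) 1) s).
Proof.
move=> s t /(congr1 (assoc (k := h \o g) (frefl _) _)); rewrite !assocE.
by move=> /(congr1 (reg _)); rewrite !regE !rmorph1 !mul1r.
Qed.

End TensTensor.

(** * The fibre product G(F(R)) and the cartesian property *)

Section Cartesian.
Variable Q : square.
Local Notation FR := (F_obj (Q := Q) (sqR Q)^o).

Lemma F_iso_tens1 (a : sqR1 Q) :
  pd_iso FR (tens (sqh1 Q) (tens (sqg1 Q) (1 : (sqR Q)^o) a) 1) =
  tens (sqh2 Q) (tens (sqg2 Q) (1 : (sqR Q)^o) 1) (sqh1 Q a).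
Proof. by rewrite /= assocE assoc_invE mulr1. Qed.

(** Through [reg] the gluing isomorphism of F(R) becomes the identity of S. Hence G(F(R)) is the
    fibre product of R1 and R2 over S, with coordinates [G_reg1] and [G_reg2] below. *)
Lemma F_regP (u1 : tensor (sqg1 Q) (sqR Q)^o) (u2 : tensor (sqg2 Q) (sqR Q)^o) :
  pd_iso FR (tens (sqh1 Q) u1 1) = tens (sqh2 Q) u2 1 <->
  sqh1 Q (reg _ u1) = sqh2 Q (reg _ u2).
Proof.
rewrite -{1}(regK u1) -{1}(regK u2) F_iso_tens1 tens_tens1.
by split=> [/tens_tens1_inj|->].
Qed.

Definition G_reg1 (y : G_type FR) : sqR1 Q := reg (sqg1 Q) (val y).1.
Definition G_reg2 (y : G_type FR) : sqR2 Q := reg (sqg2 Q) (val y).2.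

Lemma G_reg_eq y : sqh1 Q (G_reg1 y) = sqh2 Q (G_reg2 y).
Proof. by have /asboolP/F_regP := valP y. Qed.

Lemma G_reg_inj y z : G_reg1 y = G_reg1 z -> G_reg2 y = G_reg2 z -> y = z.
Proof.
rewrite /G_reg1 /G_reg2 => e1 e2; apply: val_inj; move: e1 e2.
by case: (val y) (val z) => [a b] [c d] /= /reg_inj -> /reg_inj ->.
Qed.

Lemma G_regZ r y :
  G_reg1 (r *: y) = sqg1 Q r * G_reg1 y /\ G_reg2 (r *: y) = sqg2 Q r * G_reg2 y.
Proof.
rewrite /G_reg1 /G_reg2; case: y => [[a b] P] /=.
split; first exact: (linearZ_LR (reg (sqg1 Q)) _ a).
exact: (linearZ_LR (reg (sqg2 Q)) _ b).
Qed.

Lemma G_reg_surj a b : sqh1 Q a = sqh2 Q b ->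
  exists y, G_reg1 y = a /\ G_reg2 y = b.
Proof.
move=> e.
have P : G_pred (X := FR) (tens (sqg1 Q) (1 : (sqR Q)^o) a,
                           tens (sqg2 Q) (1 : (sqR Q)^o) b).
  by apply/asboolP/F_regP; rewrite !regE !rmorph1 !mul1r.
by exists (GType P); rewrite /G_reg1 /G_reg2 /= !regE !rmorph1 !mul1r.
Qed.

Lemma cartesian_of_linear_bij (f : {linear (sqR Q)^o -> G_type FR}) :
  bijective f -> cartesian Q.
Proof.
move=> [f' fK f'K]; set e := f 1.
have fE r : f r = r *: e by rewrite -linearZ /= [_ *: _]mulr1.
have gen a b : sqh1 Q a = sqh2 Q b ->
    exists r, a = sqg1 Q r * G_reg1 e /\ b = sqg2 Q r * G_reg2 e.
  move=> /G_reg_surj[y [<- <-]]; exists (f' y).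
  by have [<- <-] := G_regZ (f' y) e; rewrite -fE f'K.
split=> [r s [e1 e2]|[a b]].
  (* Scalars with equal images in R1 and in R2 act equally on [e], so [f] takes the same value on
     them. *)
  apply: (can_inj fK); rewrite !fE.
  have [r1 r2] := G_regZ r e; have [s1 s2] := G_regZ s e.
  by apply: G_reg_inj; rewrite ?r1 ?r2 ?s1 ?s2 ?e1 ?e2.
split=> [/eqP|[r [<- <-]]]; last first.
  by apply/eqP; rewrite /sq_psi subr_eq0; apply/eqP/sq_comm.
rewrite /sq_psi subr_eq0 => /eqP /= /gen[r [-> ->]].
have [|t [t1 t2]] := gen (G_reg1 e ^+ 2) (G_reg2 e ^+ 2).
  by rewrite !rmorphXn G_reg_eq.
have [|u [u1 u2]] := gen 1 1; first by rewrite !rmorph1.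
(* In each coordinate, [e = (u e) e = u (t e) = t (u e) = t]. *)
have e1 : G_reg1 e = sqg1 Q t.
  by rewrite -[LHS]mul1r [X in X * _]u1 -mulrA -expr2 t1 mulrCA -u1 mulr1.
have e2 : G_reg2 e = sqg2 Q t.
  by rewrite -[LHS]mul1r [X in X * _]u2 -mulrA -expr2 t2 mulrCA -u2 mulr1.
by exists (r * t); rewrite /sq_phi !rmorphM e1 e2.
Qed.

End Cartesian.


(** * Images of linear maps as modules *)

Section LinearImage.
Variables (R : pzRingType) (M N : lmodType R) (f : {linear M -> N}).

Definition image_pred (n : N) : bool := `[< exists m, f m = n >].

Record linear_image := Image { image_val : N; _ : image_pred image_val }.

HB.instance Definition _ := [isSub for image_val].
HB.instance Definition _ := [Choice of linear_image by <:].

Lemma image_closed : GRing.subsemimod_closed image_pred.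
Proof.
split; first split.
- by apply/asboolP; exists 0; rewrite linear0.
- move=> _ _ /asboolP[m <-] /asboolP[n <-]; apply/asboolP.
  by exists (m + n); rewrite linearD.
- by move=> r _ /asboolP[m <-]; apply/asboolP; exists (r *: m); rewrite linearZ.
Qed.

HB.instance Definition _ :=
  GRing.SubChoice_isSubLmodule.Build R N image_pred linear_image image_closed.

Definition image_incl : {linear linear_image -> N} := val.

Lemma image_corestr_subproof m : image_pred (f m).
Proof. by apply/asboolP; exists m. Qed.

Definition image_corestr_fun m : linear_image := Image (image_corestr_subproof m).

Lemma image_corestr_linear : linear image_corestr_fun.
Proof. by move=> r m n; apply: val_inj; rewrite /= linearP. Qed.

HB.instance Definition _ :=
  GRing.isLinear.Build R M linear_image _ image_corestr_fun image_corestr_linear.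

Definition image_corestr : {linear M -> linear_image} := image_corestr_fun.

Lemma image_corestr_surj i : exists m, image_corestr m = i.
Proof. by have /asboolP[m e] := valP i; exists m; apply: val_inj. Qed.

End LinearImage.

(** * Base change of an ideal *)

Section Ideal.
Variables (R : comPzRingType) (I : lmodType R) (i : {linear I -> R^o}).

(* y u = m0 (x) i(u), so the kernel of i (x) S is killed by y. *)
Lemma tens_map_inj (S : comPzRingType) (k : {rmorphism R -> S}) (m0 : I) :
  injective i -> no_torsion (k (i m0)) (tensor k I) -> injective (tens_map k i).
Proof.
move=> i_inj tf.
have e u : k (i m0) *: u = tens k m0 (reg k (tens_map k i u)).
  elim/tens_ind: u => [|u v eu ev|m s].
  - by rewrite !linear0 tens0r.
  - by rewrite scalerDr !linearD tensDr eu ev.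
  - rewrite tens_mapE regE -tensZl tensZr -tensZl; congr tens.
    (* In an ideal [i m0 *: m = i m *: m0], since [i] sends both sides to [i m0 * i m]. *)
    by apply: i_inj; rewrite !linearZ; exact: mulrC.
by move=> u v euv; apply: tf; rewrite /= !e euv.
Qed.

(** Sums of fractions with numerators in the ideal are again such fractions. Writing 1 in this form
    and clearing denominators puts a power of [x] in the ideal. *)
Lemma pow_in_ideal (x : R) :
  (forall v, exists u, tens_map (to_loc x) i u = v) ->
  exists m n, i m = x ^+ n.
Proof.
have num u : exists m n, reg (to_loc x) (tens_map (to_loc x) i u) = Defs.frac x (i m) n.
  elim/tens_ind: u => [|u v [m [n eu]] [m' [n' ev]]|m s].
  - by exists 0, 0; rewrite !linear0.
  - by exists (x ^+ n' *: m + x ^+ n *: m'), (n + n')%N;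
      rewrite linearD linearD eu ev fracD linearD !linearZ.
  - elim/frac_ind: s => a n; exists (a *: m), n.
    by rewrite tens_mapE regE fracM linearZ mulrC.
move=> surj; have [u eu] := surj (tens (to_loc x) (1 : R^o) 1).
have [m [n]] := num u; rewrite eu regE rmorph1 mul1r => /fracP[k].
rewrite expr0 mul1r mulr1 -exprD => e; exists (x ^+ k *: m), (k + n)%N.
by rewrite e; exact: linearZ_LR.
Qed.

End Ideal.

Lemma no_torsionX (R : pzRingType) (a : R) (M : lmodType R) n :
  no_torsion a M -> no_torsion (a ^+ n) M.
Proof.
move=> tf; elim: n => [|n ih] u v /=; first by rewrite expr0 !scale1r.
by rewrite exprS -!scalerA => /tf /ih.
Qed.

(** * Gluing along a shear matrix *)

Section Shear.
Variables (R1 R2 S : comPzRingType).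
Variables (h1 : {rmorphism R1 -> S}) (h2 : {rmorphism R2 -> S}) (s : S).

Local Notation sq R := (R^o * R^o)%type.
Local Notation T2 := (tensor h2 (sq R2)).

(** The matrix (1 s; 0 1) of S^2, restricted to R1^2 and written in the basis (1, 0) (x) 1, (0, 1)
    (x) 1 of R2^2 (x) S. *)
Definition shear_in (a : sq R1) : T2 :=
  tens h2 ((1, 0) : sq R2) (h1 a.1 + s * h1 a.2) +
  tens h2 ((0, 1) : sq R2) (h1 a.2).

Lemma shear_in_linear : linear_for (h1 \; *:%R) shear_in.
Proof.
move=> r [a1 a2] [b1 b2]; rewrite /shear_in /= scalerDr !tensZr.
rewrite addrACA -!tensDr !rmorphD !rmorphM; congr (tens _ _ _ + _).
by ring.
Qed.

HB.instance Definition _ :=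
  GRing.isLinear.Build R1 (sq R1) T2 _ shear_in shear_in_linear.

Definition shear : {linear tensor h1 (sq R1) -> T2} := tens_lift shear_in.

Lemma shearE a t :
  shear (tens h1 a t) = tens h2 ((1, 0) : sq R2) ((h1 a.1 + s * h1 a.2) * t) +
                        tens h2 ((0, 1) : sq R2) (h1 a.2 * t).
Proof.
by rewrite /shear /= tens_liftE /= /shear_in scalerDr !tensZr ![t * _]mulrC.
Qed.

End Shear.

Section ShearBij.
Variables (R1 R2 S : comPzRingType).
Variables (h1 : {rmorphism R1 -> S}) (h2 : {rmorphism R2 -> S}) (s : S).

Local Notation sq R := (R^o * R^o)%type.

Lemma tens_sq (a : sq R1) t :
  tens h1 a t = tens h1 ((1, 0) : sq R1) (h1 a.1 * t) +
                tens h1 ((0, 1) : sq R1) (h1 a.2 * t).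
Proof.
case: a => a1 a2; rewrite -!tensZl -tensDl; congr tens.
by congr pair; rewrite /= ?scaler0 ?addr0 ?add0r; exact/esym/mulr1.
Qed.

(** The inverse matrix is the shear by [- s]. As [h1] and [h2] are arbitrary, exchanging them also
    gives the other composite. *)
Lemma shearK : cancel (shear h1 h2 s) (shear h2 h1 (- s)).
Proof.
apply: (@tensor_ext _ _ _ _ _ (shear h2 h1 (- s) \o shear h1 h2 s) idfun) => a.
rewrite /= [in RHS]tens_sq shearE linearD !shearE /= !rmorph1 !rmorph0.
rewrite addrACA -!tensDr.
by congr (tens _ _ _ + tens _ _ _); ring.
Qed.

End ShearBij.


Section ShearCoord.
Variables (R2 S : comPzRingType) (h2 : {rmorphism R2 -> S}).

(** Its extension [tens_fst] reads off the first coordinate of R2^2 (x) S = S^2, turning a gluing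
    condition into an equation in S. *)
Definition tens_fst_in (b : R2^o * R2^o) : S^o := h2 b.1.

Lemma tens_fst_in_linear : linear_for (h2 \; *:%R) tens_fst_in.
Proof. by move=> r b c; rewrite /tens_fst_in /= rmorphD rmorphM. Qed.

HB.instance Definition _ := GRing.isLinear.Build R2 (R2^o * R2^o)%type S^o _
  tens_fst_in tens_fst_in_linear.

Definition tens_fst : {linear tensor h2 (R2^o * R2^o)%type -> S^o} :=
  tens_lift tens_fst_in.

Lemma tens_fstE b t : tens_fst (tens h2 b t) = h2 b.1 * t.
Proof. by rewrite /tens_fst /= tens_liftE /= mulrC. Qed.

End ShearCoord.

Section TensSnd.
Variables (R S : comPzRingType) (k : {rmorphism R -> S}).

(** The second projection S^2 -> S, with its target in the form R (x)_R S that F(R) requires. *)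
Definition tens_snd_fun (a : S^o * S^o) : tensor k R^o := tens k (1 : R^o) a.2.

Lemma tens_snd_linear : linear tens_snd_fun.
Proof. by move=> r a b; rewrite /tens_snd_fun /= tensDr tensZr. Qed.

HB.instance Definition _ := GRing.isLinear.Build S (S^o * S^o)%type (tensor k R^o) _
  tens_snd_fun tens_snd_linear.

Definition tens_snd : {linear (S^o * S^o)%type -> tensor k R^o} := tens_snd_fun.

Lemma tens_snd_surj u : exists a, tens_snd a = u.
Proof. by exists (0, reg k u); exact: regK. Qed.

End TensSnd.

Lemma linear_bij_inv (R : pzRingType) (U V : lmodType R) (f : {linear U -> V}) :
  injective f -> (forall v, exists u, f u = v) ->
  exists f' : {linear V -> U}, cancel f f' /\ cancel f' f.
Proof.
move=> inj /choice[f' f'K].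
have fK : cancel f f' by move=> u; apply: inj.
pose L := GRing.isLinear.Build _ _ _ _ f' (can2_linear fK f'K).
pose F' : {linear V -> U} := HB.pack f' L.
by exists F'.
Qed.

Lemma tens_map_surj (R S : comPzRingType) (k : {rmorphism R -> S})
    (M N : lmodType R) (f : {linear M -> N}) :
  (forall n, exists m, f m = n) -> forall v, exists u, tens_map k f u = v.
Proof.
move=> surj; elim/tens_ind => [|u v [u' eu] [v' ev]|n s].
- by exists 0; rewrite linear0.
- by exists (u' + v'); rewrite linearD /= eu ev.
- by have [m <-] := surj n; exists (tens k m s); rewrite tens_mapE.
Qed.

Lemma tens_mapK (R S : comPzRingType) (k : {rmorphism R -> S})
    (M N : lmodType R) (f : {linear M -> N}) (f' : {linear N -> M}) :
  cancel f f' -> cancel (tens_map k f) (tens_map k f').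
Proof.
move=> fK; pose F := tens_map k f' \o tens_map k f.
apply: (@tensor_ext _ _ _ _ _ F idfun) => m.
by rewrite /= !tens_mapE fK.
Qed.

Section ShearDatum.
Variables (Q : square) (s : sqS Q).

Lemma shear_bij : bijective (shear (sqh1 Q) (sqh2 Q) s).
Proof.
exists (shear (sqh2 Q) (sqh1 Q) (- s)); first exact: shearK.
by have := @shearK _ _ _ (sqh2 Q) (sqh1 Q) (- s); rewrite opprK.
Qed.

Definition shear_pd : patching_datum Q := PatchingDatum shear_bij.

(** The shear changes only the first coordinate, which the projections kill. *)
Lemma shear_proj_subproof :
  pd_iso (F_obj (Q := Q) (sqR Q)^o) \o tens_map (sqh1 Q) (tens_snd (sqg1 Q)) =1
  tens_map (sqh2 Q) (tens_snd (sqg2 Q)) \o pd_iso shear_pd.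
Proof.
apply: tensor_ext => a.
rewrite [LHS]/= [RHS]/= tens_mapE shearE linearD !tens_mapE.
rewrite assocE assoc_invE /= /tens_snd_fun /= !mulr1.
by rewrite tens0r tens0 add0r.
Qed.

Definition shear_proj : pd_hom shear_pd (F_obj (Q := Q) (sqR Q)^o) :=
  @PDHom Q shear_pd (F_obj (Q := Q) (sqR Q)^o) (tens_snd (sqg1 Q))
    (tens_snd (sqg2 Q)) shear_proj_subproof.

Lemma shear_section (m : G_type shear_pd) :
  G_reg1 (G_map shear_proj m) = 1 ->
  exists p, sq_psi p = s.
Proof.
rewrite /G_reg1 /=; case: m => [[[a1 a2] [b1 b2]] P].
rewrite /= /tens_snd_fun regE rmorph1 mul1r /= => a2E; move: P => /asboolP /=.
rewrite shearE a2E /= rmorph1 => /(congr1 (tens_fst _)).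
rewrite linearD !tens_fstE /= rmorph0 mul0r addr0 rmorph1 mul1r !mulr1 => e.
(* Here [e] is the first coordinate of the gluing condition, h1(a1) + s = h2(b1); [sq_psi] subtracts
   its second term, hence the two signs. *)
by exists (- a1, - b1); rewrite /sq_psi /= !rmorphN opprK -e addrA addNr add0r.
Qed.

End ShearDatum.

(** * Surjectivity of maps between glued modules *)

Section GSurj.
Variables (Q : square) (X Y : patching_datum Q) (f : pd_hom X Y).

(** Lift both components. The gluing condition of the lift can be tested after applying [pdf2 f] (x)
    1, which is injective because [pdf2 f] has a linear inverse; there it is the gluing condition of
    [y]. *)
Lemma G_map_surj : (forall v, exists u, pdf1 f u = v) ->
  injective (pdf2 f) -> (forall v, exists u, pdf2 f u = v) ->
  forall y, exists z, G_map f z = y.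
Proof.
move=> s1 i2 s2 [[y1 y2] Py].
have [f' [f2K f'K]] := linear_bij_inv i2 s2.
have [z1 e1] := s1 y1; have [z2 e2] := s2 y2.
have P : G_pred (X := X) (z1, z2).
  apply/asboolP => /=.
  apply: (can_inj (tens_mapK (k := sqh2 Q) f2K)).
  rewrite tens_mapE e2 -[LHS]/((tens_map _ _ \o pd_iso X) _) -pdfP /= tens_mapE e1.
  by move: Py => /asboolP.
by exists (GType P); apply: val_inj; rewrite /= e1 e2.
Qed.

End GSurj.

(** * Torsion and finite generation *)

Lemma no_torsion_sub (R : pzRingType) (a : R) (M N : lmodType R)
    (f : {linear M -> N}) : injective f -> no_torsion a N -> no_torsion a M.
Proof.
by move=> inj tf u v /= e; apply/inj/tf; rewrite /= -!linearZ e.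
Qed.

Lemma no_torsion_regular (R : comPzRingType) (a : R) :
  non_zero_divisor a -> no_torsion a R^o.
Proof.
move=> nzd b c /= e; apply/eqP; rewrite -subr_eq0; apply/eqP/nzd.
by rewrite mulrBr; apply/eqP; rewrite subr_eq0; apply/eqP.
Qed.

Lemma no_torsion_prod (R : pzRingType) (a : R) (M N : lmodType R) :
  no_torsion a M -> no_torsion a N -> no_torsion a (M * N)%type.
Proof. by move=> tM tN [m n] [m' n'] [/tM -> /tN ->]. Qed.

Lemma finitely_generated_regular (R : pzRingType) : finitely_generated (R^o : lmodType R).
Proof.
exists 1%N, (fun=> 1) => m; exists (fun=> m).
by rewrite big_ord1; exact/esym/mulr1.
Qed.

Lemma finitely_generated_prod (R : pzRingType) (M N : lmodType R) :
  finitely_generated M -> finitely_generated N ->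
  finitely_generated (M * N)%type.
Proof.
move=> [p [e eP]] [q [e' eP']].
exists (p + q)%N, (fun i => match split i with
  inl i => (e i, 0) | inr j => (0, e' j) end) => -[m n].
have [c ->] := eP m; have [c' ->] := eP' n.
exists (fun i => match split i with inl i => c i | inr j => c' j end).
have sl i : split (lshift q i) = inl i :> 'I_p + 'I_q := unsplitK (inl i).
have sr i : split (rshift p i) = inr i :> 'I_p + 'I_q := unsplitK (inr i).
rewrite big_split_ord /=.
under [X in _ = X + _]eq_bigr => i _ do rewrite sl.
under [X in _ = _ + X]eq_bigr => i _ do rewrite sr.
congr pair; rewrite !raddf_sum /=.
  by rewrite [X in _ = _ + X]big1 ?addr0 // => i _; rewrite scaler0.
by rewrite [X in _ = X + _]big1 ?add0r // => i _; rewrite scaler0.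
Qed.

Lemma finitely_generated_surj (R : pzRingType) (M N : lmodType R)
    (f : {linear M -> N}) : (forall n, exists m, f m = n) ->
  finitely_generated M -> finitely_generated N.
Proof.
move=> surj [p [e eP]]; exists p, (f \o e) => n.
have [m <-] := surj n; have [c ->] := eP m; exists c.
by rewrite linear_sum; apply: eq_bigr => i _; rewrite linearZ.
Qed.

Lemma to_loc_nzd (R : comPzRingType) (x : R) : non_zero_divisor (to_loc x x).
Proof.
elim/frac_ind => a n; rewrite fracM => /fracP[k].
(* The factor [x] is absorbed into the annihilating power, which becomes [x ^+ k.+1]. *)
rewrite !mulr0 mul1r => e; apply/fracP; exists k.+1.
by rewrite !mulr0 mul1r exprSr -mulrA.
Qed.


(** * Consequences of an equivalence over a general square *)

Section Equivalence.
Variables (Q : square) (PM : Mod (sqR Q) -> Prop) (PX : PD Q -> Prop).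
Hypothesis E : induce_inverse_equivalences (functorF Q) (functorG Q) PM PX.

(** Restates GF = id with plain modules and linear maps instead of objects of the full
    subcategory. *)
Lemma equivalence_unit :
  exists eta : forall M : lmodType (sqR Q),
      PM M -> {linear G_type (F_obj M) -> M},
    (forall (M N : lmodType (sqR Q)) pM pN (f : {linear M -> N}) u,
       f (eta M pM u) = eta N pN (G_map (F_map f) u)) /\
    (forall (M : lmodType (sqR Q)) pM, exists f' : {linear M -> G_type (F_obj M)},
       cancel (eta M pM) f' /\ cancel f' (eta M pM)).
Proof.
have [FP [GQ [[eta [etaN etaI]] _]]] := E.
exists (fun M pM => eta (exist PM M pM)); split=> [M N pM pN f u|M pM].
  have e := etaN (exist PM M pM) (exist PM N pN) f.
  exact: (congr1 (fun h : {linear G_type (F_obj M) -> N} => h u) e).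
have [f' [fK1 fK2]] := etaI (exist PM M pM); exists f'; split=> u.
  exact: (congr1 (fun h : {linear G_type (F_obj M) -> G_type (F_obj M)} => h u) fK1).
exact: (congr1 (fun h : {linear M -> M} => h u) fK2).
Qed.

Lemma equivalence_counit :
  exists eps : forall X : patching_datum Q,
      PX X -> pd_hom (F_obj (G_type X)) X,
    (forall X Y pX pY (f : pd_hom X Y),
       pd_cmp f (eps X pX) = pd_cmp (eps Y pY) (F_map (G_map f))) /\
    (forall X pX, bijective (pdf1 (eps X pX)) /\ bijective (pdf2 (eps X pX))).
Proof.
have [FP [GQ [_ [eps [epsN epsI]]]]] := E.
exists (fun X pX => eps (exist PX X pX)); split=> [X Y pX pY f|X pX].
  exact: (epsN (exist PX X pX) (exist PX Y pY) f).
have [f' [fK1 fK2]] := epsI (exist PX X pX).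
by split; [exists (pdf1 f')|exists (pdf2 f')] => u;
  [have := congr1 (fun h : pd_hom _ _ => pdf1 h u) fK1
  |have := congr1 (fun h : pd_hom _ _ => pdf1 h u) fK2
  |have := congr1 (fun h : pd_hom _ _ => pdf2 h u) fK1
  |have := congr1 (fun h : pd_hom _ _ => pdf2 h u) fK2].
Qed.

Hypothesis PM_regular : PM ((sqR Q)^o : lmodType (sqR Q)).

Lemma equivalence_cartesian : cartesian Q.
Proof.
have [eta [_ etaI]] := equivalence_unit.
have [f [fK1 fK2]] := etaI _ PM_regular.
by apply: (@cartesian_of_linear_bij Q f); exists (eta _ PM_regular).
Qed.

Hypothesis PX_shear : forall s, PX (shear_pd s).
Hypothesis PM_image : forall (M : lmodType (sqR Q)) (f : {linear M -> (sqR Q)^o}),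
  PM M -> PM (linear_image f : lmodType _).
(** For the localization square this follows from a power of [x] lying in the ideal. *)
Hypothesis PM_ideal : forall (I : lmodType (sqR Q)) (i : {linear I -> (sqR Q)^o}),
  PM I -> injective i ->
  (forall v, exists u, tens_map (sqg1 Q) i u = v) ->
  (forall v, exists u, tens_map (sqg2 Q) i u = v) ->
  injective (tens_map (sqg2 Q) i).

Lemma equivalence_surjective : surjective_square Q.
Proof.
move=> s; have [eta [etaN etaI]] := equivalence_unit.
have [eps [epsN epsI]] := equivalence_counit.
have [FP [GQ _]] := E.
pose FR : patching_datum Q := F_obj (sqR Q)^o.
have pFR : PX FR := FP _ PM_regular.
pose f : pd_hom (shear_pd s) FR := shear_proj s.
(* Naturality of [eps] reads [f o eps = eps o F(G(f))]. The components of [f] are surjective and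
   those of [eps] bijective, so those of F(G(f)) are surjective. *)
have Gf1 : forall v, exists u, tens_map (sqg1 Q) (G_map f) u = v.
  move=> v; have [a ea] := tens_snd_surj (pdf1 (eps FR pFR) v).
  have [[k1 _ k1K] _] := epsI _ (PX_shear s); have [inj _] := epsI FR pFR.
  exists (k1 a); apply: (bij_inj inj).
  rewrite -ea -[a in RHS]k1K.
  exact/esym/(congr1 (fun h => pdf1 h (k1 a)) (epsN _ _ (PX_shear s) pFR f)).
have Gf2 : forall v, exists u, tens_map (sqg2 Q) (G_map f) u = v.
  move=> v; have [a ea] := tens_snd_surj (pdf2 (eps FR pFR) v).
  have [_ [k2 _ k2K]] := epsI _ (PX_shear s); have [_ inj] := epsI FR pFR.
  exists (k2 a); apply: (bij_inj inj).
  rewrite -ea -[a in RHS]k2K.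
  exact/esym/(congr1 (fun h => pdf2 h (k2 a)) (epsN _ _ (PX_shear s) pFR f)).
have [etaR' [etaRK etaR'K]] := etaI _ PM_regular.
pose p : {linear G_type (shear_pd s) -> (sqR Q)^o} :=
  eta _ PM_regular \o G_map f.
pose i : {linear linear_image p -> (sqR Q)^o} := image_incl p.
have i_inj : injective i by exact: val_inj.
have PI : PM (linear_image p : lmodType _) := PM_image p (GQ _ (PX_shear s)).
(* [i] composed with the corestriction of [p] is [eta] after [G_map f]. Since [eta] has the linear
   section [etaR'], surjectivity after base change passes from [G_map f] to [i]. *)
have i_surj (S : comPzRingType) (k : {rmorphism sqR Q -> S}) :
    (forall v, exists u, tens_map k (G_map f) u = v) ->
    forall v, exists u, tens_map k i u = v.
  move=> surj v; have [u eu] := surj (tens_map k etaR' v).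
  exists (tens_map k (image_corestr p) u).
  rewrite -[RHS](tens_mapK (k := k) etaR'K) -eu.
  rewrite -[LHS]/((tens_map k i \o tens_map k (image_corestr p)) u).
  rewrite -[RHS]/((tens_map k (eta _ PM_regular) \o tens_map k (G_map f)) u).
  rewrite -!tens_map_comp; congr (tens_map k _ u); exact: linearP_ext.
have i1 := i_surj _ _ Gf1; have i2 := i_surj _ _ Gf2.
have Gi_surj := G_map_surj (f := F_map i) i1 (PM_ideal PI i_inj i1 i2) i2.
have [|y [y1 _]] := @G_reg_surj Q 1 1; first by rewrite !rmorph1.
have [z ez] := Gi_surj y.
(* By naturality [eta y = i (eta z)], so [eta y] lies in the image of [p]. *)
have [m em] : exists m, p m = eta _ PM_regular y.
  have [m em] := image_corestr_surj (eta _ PI z); exists m.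
  by rewrite -ez -(etaN _ _ PI PM_regular i z) -em.
apply: (@shear_section _ s m).
(* [p m] is [eta (G_map f m)], and [eta] is injective, so [G_map f m = y]. *)
by rewrite -[G_map _ _](_ : y = _) // -(etaRK y) -em etaRK.
Qed.

End Equivalence.


(** * The localization square *)

Section LocalizationSquare.
Variables (R R' : comPzRingType) (g : {rmorphism R -> R'}) (x : R).
Hypotheses (x_nzd : non_zero_divisor x) (gx_nzd : non_zero_divisor (g x)).
Local Notation L := (loc_square g x).
Variables (P : Mod R -> Prop) (PX : PD L -> Prop).
(** Common features of the properties (b) and (c), so that one argument settles both. *)
Hypothesis P_fg : forall M, mod_fg_no_torsion x M -> P M.
Hypothesis P_surj : forall (M N : lmodType R) (f : {linear M -> N}),
  (forall n, exists m, f m = n) -> P M -> no_torsion x N -> P N.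
Hypothesis PX_fg : forall X, pd_fg_no_torsion X -> PX X.
Hypothesis PX_no_torsion : forall X, PX X -> pd_no_torsion X.

Lemma loc_square_of_equivalence :
  induce_inverse_equivalences (functorF L) (functorG L) P PX ->
  cartesian L /\ surjective_square L.
Proof.
move=> E; have P_regular : P (R^o : lmodType R).
  apply: P_fg; split; first exact: finitely_generated_regular.
  exact: no_torsion_regular.
split; first exact: (equivalence_cartesian E P_regular).
apply: (equivalence_surjective E P_regular) => [s|M f pM|I i PI i_inj i1 i2].
- have fg (T : comPzRingType) : finitely_generated (T^o * T^o : lmodType T)%type.
    by apply: finitely_generated_prod; exact: finitely_generated_regular.
  apply: PX_fg; split; split; try exact: fg.
    by apply: no_torsion_prod; apply/no_torsion_regular/to_loc_nzd.
  by apply: no_torsion_prod; exact: no_torsion_regular.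
(* The image is a quotient of [M] and, as a submodule of R, has no x-torsion. *)
- apply: (P_surj (@image_corestr_surj _ _ _ f) pM).
  exact: (no_torsion_sub (f := image_incl f) val_inj (no_torsion_regular x_nzd)).
- have [m [n mE]] := pow_in_ideal i1.
  (* [F] sends [I] to a datum with property [PX], so I (x) R' has no torsion for [g x], nor for its
     powers. *)
  apply: (tens_map_inj (m0 := m) i_inj); rewrite mE rmorphXn.
  by apply/no_torsionX; have [FP _] := E; have [] := PX_no_torsion (FP _ PI).
Qed.

End LocalizationSquare.

Theorem corollary5p2 (R R' : comPzRingType) (g : {rmorphism R -> R'}) (x : R)
    (x_nzd : non_zero_divisor x) (gx_nzd : non_zero_divisor (g x)) :
  (induce_inverse_equivalences
      (functorF (loc_square g x)) (functorG (loc_square g x))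
      (@mod_no_torsion R x) (@pd_no_torsion R R' g x) ->
    cartesian (loc_square g x) /\ surjective_square (loc_square g x)) /\
  (induce_inverse_equivalences
      (functorF (loc_square g x)) (functorG (loc_square g x))
      (@mod_fg_no_torsion R x) (@pd_fg_no_torsion R R' g x) ->
    cartesian (loc_square g x) /\ surjective_square (loc_square g x)).
Proof.
split; apply: loc_square_of_equivalence => //.
- by move=> M [].
- by move=> X [[_ ?] [_ ?]].
- move=> M N f surj [fg _] tN; split=> //; exact: finitely_generated_surj surj fg.
- by move=> X [[_ ?] [_ ?]].
Qed.
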